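(* Let $g:K\to L$, $g':K'\to L$ and $f,f':K\to K'$ be morphisms of augmented directed complexes, with $L$ decent; let $h$ and $h'$ be antihomotopies from $g$ to $g'f$ and from $g$ to $g'f'$ respectively, $k$ an antihomotopy from $f$ to $f'$, and $H$ a $2$-antihomotopy from $g'k+h$ to $h'$. For $i\ge0$, $u'=(u'_j)_{j\ge-1}$ in $(g'\backslash L)_i$ and $j\ge-1$, put $$(k,H)^*_i(u')_j=\begin{cases}u'_{j+1}k_j+e(u'_{-1}(1))\,H_j&\text{if }i=0,\\ u'_{j+1}k_j&\text{if }i\ge1,\end{cases}$$ with $k_{-1}=0$ and $H_{-1}=0$. Then the morphisms $(k,H)^*_i:(g'\backslash L)_i\to(g\backslash L)_{i+1}$, $i\ge0$, define a homotopy from $(f',h')^*$ to $(f,h)^*$.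
   Context: An augmented directed complex is a triple $(K,K^*,e)$ with $K$ a chain complex of abelian groups in degrees $\ge 0$, $e:K_0\to\mathbb{Z}$ a morphism with $ed_1=0$, and $K^*_n\subset K_n$ a submonoid for each $n\ge0$ (no compatibility with $d$ required). Morphisms are chain maps compatible with the augmentations and sending $K^*_n$ into $K'^*_n$. It is decent if $e(x)\ge0$ for all $x\in K^*_0$. For morphisms $p,q:K\to L$, a homotopy (resp. antihomotopy) $h$ from $p$ to $q$ is a family of group morphisms $h_i:K_i\to L_{i+1}$, $i\ge0$, with $h_i(K_i^* )\subset L^*_{i+1}$ and $d_{i+1}h_i+h_{i-1}d_i=q_i-p_i$ (resp. $d_{i+1}h_i-h_{i-1}d_i=(-1)^i(q_i-p_i)$), where $h_{-1}=0$ and $d_0=0$. A $2$-antihomotopy from an antihomotopy $h$ to an antihomotopy $h'$, both from $p$ to $q$, is a family $H_i:K_i\to L_{i+2}$, $i\ge0$, with $d_{i+2}H_i-H_{i-1}d_i=(-1)^i(h'_i-h_i)$ ($H_{-1}=0$, $d_0=0$) and $H_i(K_i^* )\subset L^*_{i+2}$. The antihomotopy $g'k+h$ from $g$ to $g'f'$ is $(g'k+h)_i=g'_{i+1}k_i+h_i$. For a morphism $g:K\to M$ of augmented directed complexes, the slice $g\backslash M$ is the augmented directed complex defined as follows. Convene $K_{-1}=M_{-1}=\mathbb{Z}$, $K^*_{-1}=M^*_{-1}=\mathbb{N}$, $d_0=e$, $g_{-1}=\mathrm{id}_{\mathbb{Z}}$, and everything is $0$ in degrees $\le-2$. Then $(g\backslash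 M)_i=\prod_{j\ge-1}\mathrm{Hom}(K_j,M_{i+j+1})$ for $i\ge1$; $(g\backslash M)_0\subset\prod_{j\ge-1}\mathrm{Hom}(K_j,M_{j+1})$ is the set of $(u_j)_{j\ge-1}$ with $(-1)^{j+1}(d_{j+1}u_j-u_{j-1}d_j)=e(u_{-1}(1))\,g_j$ for all $j\ge0$; the differential is $d_i(u)_j=(-1)^{j+1}(d_{i+j+1}u_j-u_{j-1}d_j)$ for $j\ge-1$ (with $u_{-2}=0$); the augmentation is $e(u)=e(u_{-1}(1))$; $(g\backslash M)^*_i$ consists of the $u\in(g\backslash M)_i$ with $u_j(K^*_j)\subset M^*_{i+j+1}$ for all $j\ge-1$. For $L$ decent and $h$ an antihomotopy from $g$ to $g'f$, $(f,h)^*:g'\backslash L\to g\backslash L$ is the morphism of augmented directed complexes with $(f,h)^*_0(u')_j=u'_jf_j+e(u'_{-1}(1))h_j$ and $(f,h)^*_i(u')_j=u'_jf_j$ for $i\ge1$ ($j\ge-1$, $f_{-1}=\mathrm{id}_{\mathbb{Z}}$, $h_{-1}=0$). *)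

(* Defs.v *)
(* The axioms of mathcomp.classical.boolp provide the eqType and choiceType
   structures on groups of morphisms. *)
From HB Require Import structures.
From mathcomp Require Import all_boot all_order all_algebra.
From mathcomp Require Import boolp classical_sets.

Set Implicit Arguments.
Unset Strict Implicit.
Unset Printing Implicit Defensive.

Import Order.TTheory GRing.Theory Num.Theory.
Local Open Scope ring_scope.
Local Obligation Tactic := idtac.

Section HomGroup.
Variables U V : zmodType.

HB.instance Definition _ := gen_eqMixin {additive U -> V}.
HB.instance Definition _ := gen_choiceMixin {additive U -> V}.

Lemma hom_ext (f g : {additive U -> V}) : f =1 g -> f = g.
Proof.
case: f g => [f [[Hf]]] [g [[Hg]]] /= /funext fg; subst g.
by rewrite (Prop_irrelevance Hf Hg).
Qed.

Definition hom_zero : {additive U -> V} := (\0 : U -> V).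
Definition hom_add (f g : {additive U -> V}) : {additive U -> V} := f \+ g.
Definition hom_opp (f : {additive U -> V}) : {additive U -> V} := \- f.

Fact hom_addA : associative hom_add.
Proof. by move=> f g h; apply: hom_ext => x /=; rewrite addrA. Qed.
Fact hom_addC : commutative hom_add.
Proof. by move=> f g; apply: hom_ext => x /=; rewrite addrC. Qed.
Fact hom_add0 : left_id hom_zero hom_add.
Proof. by move=> f; apply: hom_ext => x /=; rewrite add0r. Qed.
Fact hom_addN : left_inverse hom_zero hom_opp hom_add.
Proof. by move=> f; apply: hom_ext => x /=; rewrite addNr. Qed.

HB.instance Definition _ := GRing.isZmodule.Build {additive U -> V}
  hom_addA hom_addC hom_add0 hom_addN.
End HomGroup.

Lemma hom0E (U V : zmodType) x : (0 : {additive U -> V}) x = 0.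
Proof. by []. Qed.
Lemma homDE (U V : zmodType) (f g : {additive U -> V}) x :
  (f + g) x = f x + g x.
Proof. by []. Qed.
Lemma homNE (U V : zmodType) (f : {additive U -> V}) x : (- f) x = - f x.
Proof. by []. Qed.

Lemma hom_mulzE (U V : zmodType) (f : {additive U -> V}) (z : int) x :
  (f *~ z) x = f x *~ z.
Proof.
have mulnE n : (f *+ n) x = f x *+ n.
  by elim: n => [|n IHn] //; rewrite !mulrS -[LHS]/(f x + (f *+ n) x) IHn.
case: z => n; first exact: mulnE.
by rewrite NegzE !mulrNz -[LHS]/(- (f *+ n.+1) x) mulnE.
Qed.

Definition hom_comp (U V W : zmodType) (f : {additive V -> W})
  (g : {additive U -> V}) : {additive U -> W} := f \o g.
Local Notation "f \oh g" := (hom_comp f g) (at level 50, left associativity).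

(* Transport along an equality of degrees. *)
Definition cast (M : nat -> zmodType) m n (e : m = n) : {additive M m -> M n} :=
  eq_rect m (fun k => {additive M m -> M k}) idfun n e.

Lemma hom_compE (U V W : zmodType) (f : {additive V -> W})
  (g : {additive U -> V}) x : (f \oh g) x = f (g x).
Proof. by []. Qed.

Lemma cast_id (M : nat -> zmodType) n (e : n = n) x : cast M e x = x.
Proof. by rewrite (eq_axiomK e). Qed.

Lemma cast_irr (M : nat -> zmodType) m n (e e' : m = n) x :
  cast M e x = cast M e' x.
Proof. by rewrite (eq_irrelevance e e'). Qed.

Lemma cast_comp (M : nat -> zmodType) m n p (e : m = n) (e' : n = p) x :
  cast M e' (cast M e x) = cast M (etrans e e') x.
Proof. by case: p / e'; rewrite cast_id; apply: cast_irr. Qed.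

(* [adc_d n] is the differential d_(n+1), from degree n.+1 to degree n. *)
Record adc := Adc {
  adc_ob :> nat -> zmodType;
  adc_d : forall n, {additive adc_ob n.+1 -> adc_ob n};
  adc_e : {additive adc_ob 0 -> int};
  adc_pos : forall n, set (adc_ob n);
  adc_dd : forall n x, adc_d n (adc_d n.+1 x) = 0;
  adc_ed : forall x, adc_e (adc_d 0 x) = 0;
  adc_pos0 : forall n, @adc_pos n 0;
  adc_posD : forall n x y, @adc_pos n x -> @adc_pos n y -> @adc_pos n (x + y) }.
Arguments adc_d : clear implicits.
Arguments adc_e : clear implicits.
Arguments adc_pos : clear implicits.

Lemma adc_d_cast (M : adc) m n (e : m = n) (e' : m.+1 = n.+1) x :
  adc_d M n (cast M e' x) = cast M e (adc_d M m x).
Proof. by case: n / e e' => e'; rewrite !cast_id. Qed.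

Lemma adc_dd_cast (M : adc) m n (e : m = n.+1) x :
  adc_d M n (cast M e (adc_d M m x)) = 0.
Proof.
rewrite -(esymK e); move: (esym e) => e'; case: m / e' e x => e x.
by rewrite cast_id adc_dd.
Qed.

Definition decent (K : adc) : Prop := forall x, adc_pos K 0 x -> 0 <= adc_e K x.

Record adc_mor (K L : adc) := AdcMor {
  adc_fun :> forall n, {additive K n -> L n};
  adc_fun_d : forall n x, adc_fun n (adc_d K n x) = adc_d L n (adc_fun n.+1 x);
  adc_fun_e : forall x, adc_e L (adc_fun 0 x) = adc_e K x;
  adc_fun_pos : forall n x, adc_pos K n x -> adc_pos L n (adc_fun n x) }.
Arguments adc_fun_pos [K L] f [n x] : rename.

Program Definition adc_comp (K L M : adc) (g : adc_mor L M) (f : adc_mor K L) :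
  adc_mor K M := @AdcMor K M (fun n => g n \oh f n) _ _ _.
Next Obligation. by move=> K L M g f n x /=; rewrite !adc_fun_d. Qed.
Next Obligation. by move=> K L M g f x /=; rewrite !adc_fun_e. Qed.
Next Obligation. by move=> K L M g f n x Kx; do 2! apply: adc_fun_pos. Qed.

(* The family h_(i-1) d_i, which is 0 for i = 0. *)
Definition pre_d (K : adc) (T : nat -> zmodType)
    (h : forall i, {additive K i -> T i.+1}) i : {additive K i -> T i} :=
  match i with
  | 0 => hom_zero _ _
  | i'.+1 => h i' \oh adc_d K i'
  end.

Record is_homotopy (K L : adc) (p q : adc_mor K L)
    (h : forall i, {additive K i -> L i.+1}) : Prop := IsHomotopy {
  homotopy_pos : forall i x, adc_pos K i x -> adc_pos L i.+1 (h i x);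
  homotopy_d : forall i x,
    adc_d L i (h i x) + @pre_d K L h i x = q i x - p i x }.

Record antihomotopy (K L : adc) (p q : adc_mor K L) := Antihomotopy {
  ah_fun :> forall i, {additive K i -> L i.+1};
  ah_pos : forall i x, adc_pos K i x -> adc_pos L i.+1 (ah_fun i x);
  ah_d : forall i x,
    adc_d L i (ah_fun i x) - @pre_d K L ah_fun i x =
    (q i x - p i x) *~ (-1) ^+ i }.

Record antihomotopy2 (K L : adc) (p q : adc_mor K L)
    (h h' : antihomotopy p q) := Antihomotopy2 {
  ah2_fun :> forall i, {additive K i -> L i.+2};
  ah2_pos : forall i x, adc_pos K i x -> adc_pos L i.+2 (ah2_fun i x);
  ah2_d : forall i x,
    adc_d L i.+1 (ah2_fun i x) - @pre_d K (fun n => L n.+1) ah2_fun i x =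
    (h' i x - h i x) *~ (-1) ^+ i }.

(* g'k + h *)
Program Definition ah_whisker (K K' L : adc) (g : adc_mor K L)
    (g' : adc_mor K' L) (f f' : adc_mor K K') (k : antihomotopy f f')
    (h : antihomotopy g (adc_comp g' f)) : antihomotopy g (adc_comp g' f') :=
  @Antihomotopy K L _ _ (fun i => (g' i.+1 \oh k i) + h i) _ _.
Next Obligation.
move=> K K' L g g' f f' k h i x Kx; apply: adc_posD; last exact: ah_pos.
exact/adc_fun_pos/ah_pos.
Qed.
Next Obligation.
move=> K K' L g g' f f' k h i x /=.
rewrite raddfD /= -adc_fun_d.
have -> : @pre_d K L (fun i => (g' i.+1 \oh k i) + h i) i x =
          g' i (@pre_d K K' k i x) + @pre_d K L h i x.
  by case: i x => [|i] x //=; rewrite raddf0 addr0.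
rewrite opprD addrACA -raddfB !ah_d /= raddfMz raddfB -mulrzDl.
by rewrite addrA subrK.
Qed.

(* Complexes extended by Z in degree -1; everything is shifted by one, so that
   [ext K n] is K_(n-1). *)
Definition ext (K : adc) (n : nat) : zmodType :=
  match n with 0 => int | m.+1 => K m end.

Definition ext_d (K : adc) n : {additive ext K n.+1 -> ext K n} :=
  match n with 0 => adc_e K | m.+1 => adc_d K m end.

Definition ext_pos (K : adc) n : set (ext K n) :=
  match n with 0 => [set z : int | 0 <= z] | m.+1 => adc_pos K m end.

Definition ext_mor (K L : adc) (f : adc_mor K L) n :
    {additive ext K n -> ext L n} :=
  match n with 0 => idfun | m.+1 => f m end.

Definition ext_ah (K L : adc) (p q : adc_mor K L) (h : antihomotopy p q) n :
    {additive ext K n -> L n} :=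
  match n with 0 => hom_zero _ _ | m.+1 => h m end.

Definition ext_ah2 (K L : adc) (p q : adc_mor K L) (h h' : antihomotopy p q)
    (H : antihomotopy2 h h') n : {additive ext K n -> L n.+1} :=
  match n with 0 => hom_zero _ _ | m.+1 => H m end.

Arguments ext_d : clear implicits.
Arguments ext_pos : clear implicits.

Lemma ext_dd (K : adc) n x : ext_d K n (ext_d K n.+1 x) = 0.
Proof. by case: n x => [|n] x /=; rewrite ?adc_ed ?adc_dd. Qed.

Lemma ext_mor_d (K L : adc) (f : adc_mor K L) n x :
  ext_mor f n (ext_d K n x) = ext_d L n (ext_mor f n.+1 x).
Proof. by case: n x => [|n] x /=; rewrite ?adc_fun_e ?adc_fun_d. Qed.

Lemma ext_mor_pos (K L : adc) (f : adc_mor K L) n x :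
  ext_pos K n x -> ext_pos L n (ext_mor f n x).
Proof. by case: n x => [|n] x //=; apply: adc_fun_pos. Qed.

Section Families.
Variables (K : adc) (M : nat -> zmodType).

(* With n = j+1, the product over j >= -1 of the Hom(K_j, M_(i+j+1)). *)
Definition homfam (i : nat) : Type := forall n, {additive ext K n -> M (i + n)}.

HB.instance Definition _ i := Choice.on (homfam i).

Lemma family_ext i (u v : homfam i) : (forall n x, u n x = v n x) -> u = v.
Proof. by move=> uv; apply: functional_extensionality_dep => n; apply: hom_ext. Qed.

Definition family_zero i : homfam i := fun n => 0.
Definition family_add i (u v : homfam i) : homfam i := fun n => u n + v n.
Definition family_opp i (u : homfam i) : homfam i := fun n => - u n.

Fact family_addA i : associative (@family_add i).
Proof. by move=> u v w; apply: family_ext => n x /=; rewrite addrA. Qed.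
Fact family_addC i : commutative (@family_add i).
Proof. by move=> u v; apply: family_ext => n x /=; rewrite addrC. Qed.
Fact family_add0 i : left_id (@family_zero i) (@family_add i).
Proof. by move=> u; apply: family_ext => n x /=; rewrite add0r. Qed.
Fact family_addN i : left_inverse (@family_zero i) (@family_opp i) (@family_add i).
Proof. by move=> u; apply: family_ext => n x /=; rewrite addNr. Qed.

HB.instance Definition _ i := GRing.isZmodule.Build (homfam i)
  (@family_addA i) (@family_addC i) (@family_add0 i) (@family_addN i).

Lemma family0E i n : (0 : homfam i) n = 0.
Proof. by []. Qed.
Lemma familyDE i (u v : homfam i) n : (u + v) n = u n + v n.
Proof. by []. Qed.
Lemma familyNE i (u : homfam i) n : (- u) n = - u n.
Proof. by []. Qed.

(* The family u_(j-1) d_j, with u_(-2) = 0; the cast is the identity from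
   M_((i+1) + n) to M_(i + (n+1)). *)
Definition family_pre_d i (u : homfam i.+1) n : {additive ext K n -> M (i + n)} :=
  match n with
  | 0 => hom_zero _ _
  | m.+1 => cast M (addSnnS i m) \oh u m \oh ext_d K m
  end.

Lemma family_pre_dS i (u : homfam i.+1) n x :
  family_pre_d u n.+1 x = cast M (addSnnS i n) (u n (ext_d K n x)).
Proof. by []. Qed.
End Families.

Section Slice.
Variables (K M : adc) (g : adc_mor K M).

Local Notation fam := (homfam K M).

Definition family_d i (u : fam i.+1) : fam i := fun n =>
  ((adc_d M (i + n) \oh u n) - family_pre_d u n) *~ (-1) ^+ n.

(* e(u_(-1)(1)) *)
Definition weight (u : fam 0) : int := adc_e M (u 0 (1 : int)).

(* Here [u j.+1] is u_j and [u j] is u_(j-1). *)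
Definition slice0_axiom (u : fam 0) : Prop := forall j,
  ((adc_d M j \oh u j.+1) - (u j \oh ext_d K j)) *~ (-1) ^+ j.+1 =
  g j *~ weight u :> {additive K j -> M j}.

Definition slice0_pred : {pred fam 0} := fun u => `[< slice0_axiom u >].

Lemma slice0_axiomP (u : fam 0) : slice0_axiom u <->
  forall j x, (adc_d M j (u j.+1 x) - u j (ext_d K j x)) *~ (-1) ^+ j.+1 =
              g j x *~ weight u.
Proof.
split=> u0 j => [x|]; last by apply: hom_ext => x; rewrite !hom_mulzE -u0.
have := congr1 (fun f : {additive _ -> _} => f x) (u0 j).
by rewrite !hom_mulzE.
Qed.

Fact weight_is_zmod_morphism : zmod_morphism weight.
Proof. by move=> u v; rewrite /weight familyDE familyNE homDE homNE raddfB. Qed.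
HB.instance Definition _ :=
  GRing.isZmodMorphism.Build (fam 0) int weight weight_is_zmod_morphism.

Fact slice0_zmod_closed : zmod_closed slice0_pred.
Proof.
split=> [|u v /asboolP/slice0_axiomP u0 /asboolP/slice0_axiomP v0];
  apply/asboolP/slice0_axiomP => j x.
  by rewrite (raddf0 weight) !family0E !hom0E !raddf0 addr0 mul0rz.
rewrite (raddfB weight) mulrzBr -u0 -v0 -mulrzBl !familyDE !familyNE.
rewrite !homDE !homNE (raddfB (adc_d M j)); congr (_ *~ _).
by rewrite !opprD !opprK [LHS]addrACA.
Qed.
HB.instance Definition _ :=
  GRing.isZmodClosed.Build (fam 0) slice0_pred slice0_zmod_closed.

Record slice0 := Slice0 { slice0_val :> fam 0; _ : slice0_val \in slice0_pred }.
HB.instance Definition _ := [isSub for slice0_val].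
HB.instance Definition _ := [Choice of slice0 by <:].
HB.instance Definition _ := [SubChoice_isSubZmodule of slice0 by <:].

Lemma slice0P (u : slice0) : slice0_axiom u.
Proof. by case: u => u /= /asboolP. Qed.

Definition slice_ob (i : nat) : zmodType :=
  match i with 0 => slice0 | i'.+1 => fam i'.+1 end.

Definition slice_fam i : slice_ob i -> fam i :=
  match i with 0 => slice0_val | i'.+1 => idfun end.

Lemma family_dE i (u : fam i.+1) n x :
  family_d u n x = (adc_d M (i + n) (u n x) - family_pre_d u n x) *~ (-1) ^+ n.
Proof. by rewrite /family_d hom_mulzE. Qed.

Fact family_d_is_zmod_morphism i : zmod_morphism (@family_d i).
Proof.
move=> u v; apply: family_ext => n x.
rewrite familyDE familyNE homDE homNE !family_dE -mulrzBl; congr (_ *~ _).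
rewrite familyDE familyNE homDE homNE (raddfB (adc_d M _)).
case: n x => [|n] x; first by rewrite !subr0.
rewrite !family_pre_dS familyDE familyNE homDE homNE (raddfB (cast M _)).
by rewrite !opprD !opprK [LHS]addrACA.
Qed.
HB.instance Definition _ i := GRing.isZmodMorphism.Build (fam i.+1) (fam i)
  (@family_d i) (@family_d_is_zmod_morphism i).

Lemma weight_d (u : fam 1) : weight (family_d u) = 0.
Proof. by rewrite /weight family_dE subr0 adc_ed. Qed.

Lemma family_pre_dd i (u : fam i.+1) n x : family_pre_d u n (ext_d K n x) = 0.
Proof. by case: n x => [|n] x //; rewrite family_pre_dS ext_dd !raddf0. Qed.

Lemma adc_d_family_d i (u : fam i.+1) n x :
  adc_d M (i + n) (cast M (addnS i n) (family_d u n.+1 x)) =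
  family_d u n (ext_d K n x).
Proof.
rewrite !family_dE family_pre_dS family_pre_dd subr0 !raddfMz /=.
rewrite (raddfB (cast M _)) (raddfB (adc_d M _)) adc_dd_cast sub0r.
by rewrite cast_comp cast_id exprS mulN1r mulrNz mulNrz opprK.
Qed.

Fact family_d_slice0 (u : fam 1) : family_d u \in slice0_pred.
Proof.
apply/asboolP/slice0_axiomP => j x; rewrite weight_d mulr0z.
by rewrite -adc_d_family_d cast_id subrr mul0rz.
Qed.

Lemma family_dd i (u : fam i.+2) : family_d (family_d u) = 0.
Proof.
apply: family_ext => n x; rewrite family0E hom0E family_dE.
case: n x => [|n] x.
  by rewrite subr0 family_dE subr0 raddfMz adc_dd mul0rz.
rewrite family_pre_dS -adc_d_family_d -(adc_d_cast _ (congr1 S (addSnnS i n))).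
by rewrite cast_comp cast_id subrr mul0rz.
Qed.

Definition slice_d0 (u : fam 1) : slice0 := Slice0 (family_d_slice0 u).

Fact slice_d0_is_zmod_morphism : zmod_morphism slice_d0.
Proof. by move=> u v; apply: val_inj; rewrite raddfB /= raddfB. Qed.
HB.instance Definition _ :=
  GRing.isZmodMorphism.Build (fam 1) slice0 slice_d0 slice_d0_is_zmod_morphism.

Definition slice_d i : {additive slice_ob i.+1 -> slice_ob i} :=
  match i with 0 => slice_d0 | i'.+1 => @family_d i'.+1 end.

Definition slice_e : {additive slice_ob 0 -> int} :=
  weight \o (val : slice0 -> fam 0).

Definition slice_pos i : set (slice_ob i) := [set u |
  forall n x, ext_pos K n x -> adc_pos M (i + n) (slice_fam u n x)].

Fact slice_dd i (u : slice_ob i.+2) : slice_d i (slice_d i.+1 u) = 0.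
Proof. by case: i u => [|i] u; [apply: val_inj|]; rewrite /= family_dd. Qed.

Fact slice_ed (u : slice_ob 1) : slice_e (slice_d 0 u) = 0.
Proof. exact: weight_d. Qed.

Fact slice_famD i (u v : slice_ob i) : slice_fam (u + v) = slice_fam u + slice_fam v.
Proof. by case: i u v. Qed.

Fact slice_pos0 i : @slice_pos i 0.
Proof. by move=> n x _; case: i => [|i]; apply: adc_pos0. Qed.

Fact slice_posD i (u v : slice_ob i) :
  slice_pos u -> slice_pos v -> slice_pos (u + v).
Proof.
move=> u0 v0 n x Kx; rewrite slice_famD familyDE homDE.
by apply: adc_posD; [apply: u0|apply: v0].
Qed.

Definition slice : adc := Adc slice_dd slice_ed slice_pos0 slice_posD.
End Slice.

Lemma adc_pos_mulz (M : adc) n x (z : int) :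
  adc_pos M n x -> 0 <= z -> adc_pos M n (x *~ z).
Proof.
move=> Mx; case: z => // m _; rewrite -pmulrn.
elim: m => [|m IHm]; first exact: adc_pos0.
by rewrite mulrS; apply: adc_posD.
Qed.

Lemma ext_ah_pos (K L : adc) (p q : adc_mor K L) (h : antihomotopy p q) n x :
  ext_pos K n x -> adc_pos L n (ext_ah h n x).
Proof. by case: n x => [|n] x Kx; [apply: adc_pos0|apply: ah_pos]. Qed.

Lemma ext_ah_d (K L : adc) (p q : adc_mor K L) (h : antihomotopy p q) i x :
  adc_d L i (ext_ah h i.+1 x) - ext_ah h i (ext_d K i x) =
  (q i x - p i x) *~ (-1) ^+ i.
Proof. by rewrite -(ah_d h); case: i x. Qed.

Section SliceMap.
Variables (K K' L : adc) (g : adc_mor K L) (g' : adc_mor K' L).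
Variable f : adc_mor K K'.

(* The family u'_j f_j *)
Definition family_comp i (u : homfam K' L i) : homfam K L i :=
  fun n => u n \oh ext_mor f n.

Fact family_comp_is_zmod_morphism i : zmod_morphism (@family_comp i).
Proof. by move=> u v; apply: family_ext. Qed.
HB.instance Definition _ i := GRing.isZmodMorphism.Build
  (homfam K' L i) (homfam K L i) (@family_comp i) (@family_comp_is_zmod_morphism i).

Variable h : antihomotopy g (adc_comp g' f).

(* The family u'_j f_j + e(u'_(-1)(1)) h_j *)
Definition family_map0 (u : homfam K' L 0) : homfam K L 0 :=
  fun n => (u n \oh ext_mor f n) + ext_ah h n *~ weight u.

Fact family_map0_is_zmod_morphism : zmod_morphism family_map0.
Proof.
move=> u v; apply: family_ext => n x; rewrite familyDE familyNE homDE homNE.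
rewrite !homDE !hom_mulzE (raddfB (@weight K' L)) mulrzBr !opprD.
exact: addrACA.
Qed.
HB.instance Definition _ := GRing.isZmodMorphism.Build
  (homfam K' L 0) (homfam K L 0) family_map0 family_map0_is_zmod_morphism.

Lemma weight_map0 u : weight (family_map0 u) = weight u.
Proof. by rewrite /weight homDE hom_mulzE mul0rz addr0. Qed.

Fact family_map0_slice0 (u : slice0 g') : family_map0 u \in slice0_pred g.
Proof.
apply/asboolP/slice0_axiomP => j x; rewrite weight_map0.
have /slice0_axiomP/(_ j (f j x)) u0 := slice0P u.
rewrite !homDE !hom_mulzE !hom_compE ext_mor_d /=.
rewrite (raddfD (adc_d L j)) raddfMz opprD addrACA -mulrzBl ext_ah_d /= mulrzDl.
rewrite u0 -!mulrzA [_ * (_ * _)]mulrCA exprS mulN1r mulrN -expr2 sqrr_sign.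
by rewrite mulrN1 mulrNz -mulrzBl opprB addrC subrK.
Qed.

Definition slice_map0 (u : slice0 g') : slice0 g := Slice0 (family_map0_slice0 u).

Fact slice_map0_is_zmod_morphism : zmod_morphism slice_map0.
Proof. by move=> u v; apply: val_inj; rewrite raddfB /= !raddfB. Qed.
HB.instance Definition _ := GRing.isZmodMorphism.Build
  (slice0 g') (slice0 g) slice_map0 slice_map0_is_zmod_morphism.

Definition slice_map_fun i : {additive slice g' i -> slice g i} :=
  match i with 0 => slice_map0 | i'.+1 => @family_comp i'.+1 end.

Hypothesis L_decent : decent L.

Fact slice_map_d i u :
  slice_map_fun i (adc_d (slice g') i u) = adc_d (slice g) i (slice_map_fun i.+1 u).
Proof.
have E i' (v : homfam K' L i'.+1) :
    family_comp (family_d v) = family_d (family_comp v).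
  apply: family_ext => n x; rewrite hom_compE !family_dE hom_compE.
  by case: n x => [|n] x //; rewrite !family_pre_dS -ext_mor_d.
case: i u => [|i] u; last exact: E.
apply: val_inj; rewrite /= -E; apply: family_ext => n x.
by rewrite homDE hom_mulzE weight_d mulr0z addr0.
Qed.

Fact slice_map_e u : adc_e (slice g) (slice_map_fun 0 u) = adc_e (slice g') u.
Proof. exact: weight_map0. Qed.

Lemma slice_weight_ge0 (u : slice g' 0) : adc_pos (slice g') 0 u -> 0 <= weight u.
Proof. by move=> u0; apply: L_decent; apply: (u0 0 1). Qed.

Fact slice_map_pos i u :
  adc_pos (slice g') i u -> adc_pos (slice g) i (slice_map_fun i u).
Proof.
case: i u => [|i] u u0 n x Kx; last by apply: u0; apply: ext_mor_pos.
rewrite homDE hom_mulzE; apply: adc_posD; first by apply: u0; apply: ext_mor_pos.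
by apply: adc_pos_mulz; [apply: ext_ah_pos|apply: slice_weight_ge0].
Qed.

(* (f, h)^* *)
Definition slice_map : adc_mor (slice g') (slice g) :=
  AdcMor slice_map_d slice_map_e slice_map_pos.
End SliceMap.

Section SliceHomotopy.
Variables (K K' L : adc) (g : adc_mor K L) (g' : adc_mor K' L).
Variables (f f' : adc_mor K K') (k : antihomotopy f f').
Variables (p q : adc_mor K L) (h h' : antihomotopy p q) (H : antihomotopy2 h h').

(* The family u'_(j+1) k_j; the cast is the identity from M_(i + (n+1)) to
   M_((i+1) + n). *)
Definition family_hcomp i (u : homfam K' L i) : homfam K L i.+1 :=
  fun n => cast L (esym (addSnnS i n)) \oh u n.+1 \oh ext_ah k n.

Fact family_hcomp_is_zmod_morphism i : zmod_morphism (@family_hcomp i).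
Proof.
by move=> u v; apply: family_ext => n x; rewrite !hom_compE raddfB.
Qed.
HB.instance Definition _ i := GRing.isZmodMorphism.Build (homfam K' L i)
  (homfam K L i.+1) (@family_hcomp i) (@family_hcomp_is_zmod_morphism i).

(* The family u'_(j+1) k_j + e(u'_(-1)(1)) H_j *)
Definition slice_homotopy0 (u : slice0 g') : homfam K L 1 :=
  fun n => (family_hcomp u n : {additive ext K n -> L n.+1}) +
           ext_ah2 H n *~ weight u.

Fact slice_homotopy0_is_zmod_morphism : zmod_morphism slice_homotopy0.
Proof.
move=> u v; apply: family_ext => n x; rewrite familyDE familyNE homDE homNE.
rewrite !homDE !hom_mulzE (raddfB (@weight K' L)) mulrzBr !opprD.
by rewrite (raddfB (@family_hcomp 0)); apply: addrACA.
Qed.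
HB.instance Definition _ := GRing.isZmodMorphism.Build (slice0 g')
  (homfam K L 1) slice_homotopy0 slice_homotopy0_is_zmod_morphism.

(* (k, H)^*_i *)
Definition slice_homotopy i : {additive slice g' i -> slice g i.+1} :=
  match i with 0 => slice_homotopy0 | i'.+1 => @family_hcomp i'.+1 end.
End SliceHomotopy.

(* Main.v *)
Require Import Defs.
From mathcomp Require Import all_boot all_order all_algebra.

(** Write [S] for the homotopy and [w] for the integer [e(u_(-1)(1))].  In the
    component of index [j] of [d S u], the part involving [k] is
    [(-1)^(j+1) (d u_(j+1) k_j - u_j k_(j-1) d)].  Subtracting and adding
    [u_j d k_j] splits it into [(-1)^(j+1) u_j (d k_j - k_(j-1) d)], which is
    [u_j f_j - u_j f'_j] because [k] is an antihomotopy, and a remainder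
    [(-1)^(j+1) (d u_(j+1) - u_j d) k_j].  This splitting holds in every degree:
    it is [family_d_hcomp].

    In degrees [i >= 1] the remainder is [- (d u)_(j+1) k_j], and [S d u]
    compensates it: this is [family_hcomp_d].  In degree [0] there is no
    [S d], but the equation defining the degree [0] part of the slice turns the
    remainder into [- w g'_(j+1) k_j].  The terms in [H] contribute
    [- w (h'_j - g'_(j+1) k_j - h_j)], so that [g' k] cancels and
    [w h_j - w h'_j] is left: this is [family_d_slice_homotopy0].
    In degree [1], [S d u] has no term in [H], since the augmentation of a boundary vanishes.

    Positivity of [S u] in degree [0] requires [w >= 0], which decency of [L]
    provides.

    Families are indexed by [n = j + 1], so the signs [(-1)^(j+1)] above are
    [(-1) ^+ n] below. *)

Set Implicit Arguments.
Unset Strict Implicit.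
Unset Printing Implicit Defensive.

Import Order.TTheory GRing.Theory Num.Theory.
Local Open Scope ring_scope.

Lemma adc_pos_cast (M : adc) m n (e : m = n) x :
  adc_pos M m x -> adc_pos M n (cast M e x).
Proof. by case: n / e; rewrite cast_id. Qed.

Lemma ext_ah2_pos (K L : adc) (p q : adc_mor K L) (h h' : antihomotopy p q)
    (H : antihomotopy2 h h') n x :
  ext_pos K n x -> adc_pos L n.+1 (ext_ah2 H n x).
Proof. by case: n x => [|n] x Kx; [apply: adc_pos0|apply: ah2_pos]. Qed.

Lemma ext_ah2_d (K L : adc) (p q : adc_mor K L) (h h' : antihomotopy p q)
    (H : antihomotopy2 h h') i x :
  adc_d L i.+1 (ext_ah2 H i.+1 x) - ext_ah2 H i (ext_d K i x) =
  (h' i x - h i x) *~ (-1) ^+ i.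
Proof. by rewrite -(ah2_d H); case: i x. Qed.

Section Homotopy.
Variables (K K' L : adc) (f f' : adc_mor K K') (k : antihomotopy f f').

Lemma family_hcomp_pos i (u : homfam K' L i) :
    (forall n x, ext_pos K' n x -> adc_pos L (i + n) (u n x)) ->
  forall n x, ext_pos K n x -> adc_pos L (i.+1 + n) (family_hcomp k u n x).
Proof.
move=> u0 n x Kx; rewrite /family_hcomp !hom_compE.
by apply: adc_pos_cast; apply: u0; apply: ext_ah_pos.
Qed.

(** The last bracket is not expressed through the differential of [u], because
    for [i = 0] there is none: the slice equation takes its place. *)
Lemma family_d_hcomp i (u : homfam K' L i) n x :
  family_d (family_hcomp k u) n x =
    u n (ext_mor f n x) - u n (ext_mor f' n x) +
    (adc_d L (i + n) (cast L (addnS i n) (u n.+1 (ext_ah k n x))) -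
     u n (ext_d K' n (ext_ah k n x))) *~ (-1) ^+ n.
Proof.
rewrite family_dE /family_hcomp !hom_compE.
rewrite (cast_irr (esym (addSnnS i n)) (addnS i n)).
case: n x => [|n] x; first by rewrite /= !raddf0 subrr addr0 mul0rz addr0.
rewrite family_pre_dS !hom_compE cast_comp cast_id.
have kd : ext_ah k n (ext_d K n x) =
    ext_d K' n.+1 (ext_ah k n.+1 x) - (f' n x - f n x) *~ (-1) ^+ n.
  by rewrite -(ext_ah_d k) opprB addrC subrK.
rewrite kd (raddfB (u n.+1)) opprB addrCA mulrzDl; congr (_ + _).
rewrite raddfMz -mulrzA exprS mulN1r mulrN -expr2 sqrr_sign mulrN1z.
by rewrite raddfB opprB.
Qed.

(** With one more degree available, the bracket left over in [family_d_hcomp]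
    is the component [n.+1] of the differential of [u], with the opposite
    sign. *)
Lemma family_hcomp_d i (u : homfam K' L i.+1) :
  family_d (family_hcomp k u) + family_hcomp k (family_d u) =
  family_comp f u - family_comp f' u.
Proof.
apply: family_ext => n x; rewrite !familyDE familyNE !homDE homNE.
rewrite family_d_hcomp -addrA -[RHS]addr0; congr (_ + _).
rewrite [family_hcomp k _ n x]hom_compE hom_compE family_dE family_pre_dS.
rewrite raddfMz raddfB /= cast_comp cast_id.
rewrite -(adc_d_cast _ (congr1 S (esym (addSnnS i n)))).
rewrite (cast_irr _ (addnS i.+1 n)).
by rewrite exprS mulN1r mulrNz addrN.
Qed.

Variables (g : adc_mor K L) (g' : adc_mor K' L).
Variables (h : antihomotopy g (adc_comp g' f)).
Variables (h' : antihomotopy g (adc_comp g' f')).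
Variable H : antihomotopy2 (ah_whisker k h) h'.

(** The antihomotopy [h'] is compared with [g' k + h] through [H]; the term
    [g' k] is exactly what the slice equation of [u] produces along [k]. *)
Lemma family_d_slice_homotopy0 (u : slice0 g') :
  family_d (slice_homotopy0 k H u) = family_map0 h u - family_map0 h' u.
Proof.
have -> : slice_homotopy0 k H u =
    family_hcomp k u + (fun n => ext_ah2 H n *~ weight u : {additive _ -> _}).
  by apply: family_ext.
rewrite raddfD; apply: family_ext => n x.
rewrite !familyDE familyNE !homDE homNE family_d_hcomp family_dE -addrA.
rewrite !homDE !hom_mulzE opprD [RHS]addrACA; congr (_ + _); rewrite cast_id.
case: n x => [|n] x; first by rewrite /= !(raddf0, mul0rz, subrr, addr0).
(* The slice equation one degree up, hence with the opposite sign. *)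
have /slice0_axiomP/(_ n.+1 (k n x)) := slice0P u.
rewrite exprS mulN1r mulrNz => /(canRL (@opprK _)) -> /=.
rewrite cast_id !hom_mulzE (raddfMz (adc_d L n.+1)) -mulrzBl.
have -> : adc_d L n.+1 (H n x) - ext_ah2 H n (ext_d K n x) =
    (h' n x - (g' n.+1 (k n x) + h n x)) *~ (-1) ^+ n by rewrite -(ext_ah2_d H).
rewrite -!mulrzA [weight u * _]mulrC mulrA exprS mulrCA -expr2 sqrr_sign.
rewrite mulr1 mulN1r mulrNz -opprD -mulrzDl -mulrzBl -mulNrz.
by rewrite addrCA [- (_ + h n x)]opprD addNKr opprB.
Qed.
End Homotopy.

Theorem proposition10p4p2 (K K' L : adc) (g : adc_mor K L) (g' : adc_mor K' L)
  (f f' : adc_mor K K') (L_decent : decent L)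
  (h : antihomotopy g (adc_comp g' f)) (h' : antihomotopy g (adc_comp g' f'))
  (k : antihomotopy f f') (H : antihomotopy2 (ah_whisker k h) h') :
  is_homotopy (slice_map h' L_decent) (slice_map h L_decent)
    (slice_homotopy g g' k H).
Proof.
split=> [[|i] u u0 | [|[|i]] u].
- move=> n x Kx; rewrite homDE hom_mulzE; apply: adc_posD.
    exact: (@family_hcomp_pos _ _ _ _ _ k 0 u).
  by apply: adc_pos_mulz; [apply: ext_ah2_pos|apply: slice_weight_ge0 u0].
- exact: family_hcomp_pos.
- by apply: val_inj; rewrite /= addr0 family_d_slice_homotopy0.
(* A boundary has augmentation zero, so the term in [H] vanishes. *)
- rewrite /= -(family_hcomp_d k); congr (_ + _); apply: family_ext => n x.
  by rewrite homDE hom_mulzE weight_d mulr0z addr0.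
- exact: family_hcomp_d.
Qed.
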